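(* Let $A$ be a finite alphabet, $0\in A$, and let $(\Sigma,F)$ be a partial cellular automaton on a transitive subshift of finite type $\Sigma\subseteq A^{\mathbb M}$, where $\mathbb M\in\{\mathbb N,\mathbb Z\}$. If $(\Sigma,F)$ is asymptotically $0$-nilpotent, then it is $0$-nilpotent.
   Context: $A^{\mathbb M}$ carries the product topology of the discrete topology. The shift is $\sigma(x)_i=x_{i+1}$. A subshift is a nonempty closed set $\Sigma\subseteq A^{\mathbb M}$ with $\sigma(\Sigma)\subseteq\Sigma$ if $\mathbb M=\mathbb N$ (onesided), and $\sigma(\Sigma)=\Sigma$ if $\mathbb M=\mathbb Z$ (twosided). It is of finite type (SFT) if there is a finite set $L$ of finite words over $A$ such that $\Sigma$ is the set of all configurations in $A^{\mathbb M}$ in which no word of $L$ occurs. $\Sigma$ is transitive if the set of $x\in\Sigma$ whose positive orbit $\{\sigma^t(x)\mid t\ge1\}$ is dense in $\Sigma$ is residual in $\Sigma$ (equivalently, for all nonempty open $U,V\subseteq\Sigma$ there are $x\in U$ and $t>0$ with $\sigma^t(x)\in V$). A partial cellular automaton (PCA) is a pair $(\Sigma,F)$ with $\Sigma$ a subshift and $F:\Sigma\to\Sigma$ continuous with $F\sigma=\sigma F$. The asymptotic set $\omega_F$ is the set of all $y\in\Sigma$ such that for some $x\in\Sigma$, $y$ is an adhering value (the limit of a subsequence) of the sequence $(F^t(x))_{t\in\mathbb N}$. Let $\mathbf 0$ be the configuration all of whose cells are $0$. $(\Sigma,F)$ is asymptotically $0$-nilpotent if $\omega_F=\{\mathbf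 0\}$; it is $0$-nilpotent if there is $q\in\mathbb N$ such that $F^t(\Sigma)=\{\mathbf 0\}$ for all $t\ge q$. *)

(* Defs.v *)
From mathcomp Require Import all_boot all_order all_algebra.
From mathcomp Require Import all_classical topology sequences borel_hierarchy.

Set Implicit Arguments.
Unset Strict Implicit.
Unset Printing Implicit Defensive.

Import Order.TTheory GRing.Theory.
Local Open Scope classical_set_scope.
Local Open Scope ring_scope.

Variant sidedness := onesided | twosided.

(* Both monoids of cells are semirings, so that i + k%:R is the cell lying
   k steps to the right of i. *)
Definition cell (m : sidedness) : nzSemiRingType :=
  match m with onesided => nat | twosided => int end.

Definition config (A : finType) (m : sidedness) : topologicalType :=
  prod_topology (fun _ : cell m => discrete_topology A).

Definition shift (A : finType) (m : sidedness) (x : config A m) : config A m :=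
  fun i => x (i + 1).

Definition const_config (A : finType) (m : sidedness) (a : A) : config A m :=
  fun _ => a.

Definition is_subshift (A : finType) (m : sidedness) (S : set (config A m)) :=
  [/\ S !=set0, closed S &
      match m with
      | onesided => @shift A m @` S `<=` S
      | twosided => @shift A m @` S = S
      end].

Record subshift (A : finType) (m : sidedness) := Subshift {
  subshift_set :> set (config A m);
  subshiftP : is_subshift subshift_set
}.

Lemma subshift_shift (A : finType) (m : sidedness) (S : subshift A m) (x : S) :
  subshift_set S (shift (set_val x)).
Proof.
have Sx : (@shift A m @` S) (shift (set_val x)).
  by exists (set_val x) => //; exact: set_valP.
have [_ _] := subshiftP S.
by case: m S x Sx => S x Sx sub; [exact: sub | have := Sx; rewrite [X in X _]sub].
Qed.

(* The elements of the type S are the points of the subshift, and this type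
   carries the subspace topology (subtype_topology.v). *)
Definition sigma (A : finType) (m : sidedness) (S : subshift A m) (x : S) : S :=
  SigSub (mem_set (subshift_shift x)).

Definition occurs (A : finType) (m : sidedness) (w : seq A) (x : config A m) :=
  exists i : cell m, mkseq (fun k => x (i + k%:R) : A) (size w) = w.

Definition finite_type (A : finType) (m : sidedness) (S : subshift A m) :=
  exists2 L : set (seq A), finite_set L &
    S = [set x | forall w, L w -> ~ occurs w x] :> set (config A m).

Definition residual (T : topologicalType) (B : set T) :=
  exists2 G : set T, Gdelta_dense G & G `<=` B.

Definition positive_orbit (A : finType) (m : sidedness) (S : subshift A m)
    (x : S) : set S :=
  [set iter t (@sigma A m S) x | t in [set t | (1 <= t)%N]].

Definition transitive_subshift (A : finType) (m : sidedness)
    (S : subshift A m) :=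
  residual [set x : S | dense (positive_orbit x)].

Definition partial_cellular_automaton (A : finType) (m : sidedness)
    (S : subshift A m) (F : S -> S) :=
  continuous F /\ F \o @sigma A m S = @sigma A m S \o F.

Definition asymptotic_set (A : finType) (m : sidedness) (S : subshift A m)
    (F : S -> S) : set S :=
  [set y | exists x : S, exists2 phi : nat -> nat,
     {homo phi : s t / (s < t)%N} & iter (phi n) F x @[n --> \oo] --> y].

Definition asymptotically_nilpotent_to (A : finType) (m : sidedness)
    (zero : A) (S : subshift A m) (F : S -> S) :=
  set_val @` asymptotic_set F = [set const_config zero : config A m].

Definition nilpotent_to (A : finType) (m : sidedness)
    (zero : A) (S : subshift A m) (F : S -> S) :=
  exists q : nat, forall t : nat, (q <= t)%N ->
    set_val @` range (iter t F) = [set const_config zero : config A m].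

(* Main.v *)
Require Import Defs.
From mathcomp Require Import all_boot all_order all_algebra.
From mathcomp Require Import all_classical topology.
From mathcomp Require Import borel_hierarchy zify.

Set Implicit Arguments.
Unset Strict Implicit.
Unset Printing Implicit Defensive.

Import Order.TTheory GRing.Theory.
Local Open Scope classical_set_scope.
Local Open Scope ring_scope.

(** An asymptotically nilpotent automaton that is not nilpotent would have a
    configuration whose cell 0 is non-zero infinitely often, and compactness
    forbids that; the proof builds this configuration.

    Compactness turns the hypothesis on the asymptotic set into pointwise
    decay: on every ball of cells, the orbit of each point is eventually zero
    ([orbit_vanishes]), with a delay that depends on the point.  A Baire
    category argument ([baire], [uniform_vanishing]) makes the delay J uniform
    on some cylinder.  The word w of that cylinder is a wall: wherever w occurs
    in a configuration, a block of r cells is zero at all times after J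
    ([wall_word]), where r bounds both the radius of the local rule and the
    length of the forbidden words.  Information does not cross such a block,
    and zero blocks of this size are where configurations of a subshift of
    finite type can be glued ([splice]).

    Suppose now that cell 0 can be non-zero arbitrarily late.  Take points
    that are non-zero in cell 0 at later and later times, and a limit x of
    them.  The orbit of x vanishes on a large ball from some time s on, so the
    points close to x vanish there during a long time after s, and yet come
    back to life in cell 0 ([late_revival]).  This behaviour depends only on a
    finite word.  By transitivity some point contains every word infinitely
    often to the right, hence contains this word between two walls; the states
    at time s between the walls, completed by zeros, form a point whose
    activity never leaves a bounded region ([confined_late_revival]).

    A confined point dies in finite time.  Put around it a confined point that
    stays zero near it until it is dead and revives cell 0 afterwards: the two
    evolve independently, so their superposition is a confined point that
    agrees with the first one on an arbitrary ball and is non-zero in cell 0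
    at a late time ([superposition]).  Within the confined points late
    activity in cell 0 is thus dense, against [uniform_vanishing]. *)

Lemma homo_ltn_geq (phi : nat -> nat) n : {homo phi : s t / (s < t)%N} ->
  (n <= phi n)%N.
Proof.
by move=> hom; elim: n => // n IH; exact: leq_ltn_trans IH (hom _ _ (ltnSn n)).
Qed.

(** * Cells and balls of cells *)

(** With this size, the cells [i + d] for [absc d <= r] are the interval of
    radius [r] centred at [i] in the twosided case, and the interval that
    starts at [i] in the onesided case: in both cases they are the cells that a
    local rule of radius [r] reads at [i]. *)
Definition absc (m : sidedness) : cell m -> nat :=
  match m with
  | onesided => fun i : nat => i
  | twosided => fun i : int => `|i|%N
  end.

Lemma absc0 m : absc (0 : cell m) = 0%N.
Proof. by case: m. Qed.

Lemma absc_natr m k : absc (k%:R : cell m) = k.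
Proof. by case: m => /=; rewrite ?natn ?natz. Qed.

Lemma absc_addl m (i d : cell m) : (absc (i + d)%R <= absc i + absc d)%N.
Proof. by case: m i d => //= i d; lia. Qed.

Lemma absc_subl m (i d : cell m) : (absc i <= absc (i + d)%R + absc d)%N.
Proof.
by case: m i d => /= i d; [rewrite -addnA leq_addr | lia].
Qed.

Definition ball_cells (m : sidedness) (M : nat) : seq (cell m) :=
  match m with
  | onesided => iota 0 M.+1
  | twosided => map Posz (iota 0 M.+1) ++ map Negz (iota 0 M)
  end.

Lemma mem_ball_cells m M (i : cell m) : (absc i <= M)%N -> i \in ball_cells m M.
Proof.
case: m i => /= [i iM|i iM].
  by have : i \in iota 0 M.+1 by rewrite mem_iota.
suff : i \in map Posz (iota 0 M.+1) ++ map Negz (iota 0 M) by [].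
rewrite mem_cat; case: i iM => n nM; apply/orP; [left|right];
  by apply: map_f; rewrite mem_iota.
Qed.

(** * The topology of a subshift *)

Section subshift_topology.
Context (A : finType) (m : sidedness).

Lemma nbhs_cylinder M (x : config A m) :
  nbhs x [set y : config A m | forall i, (absc i <= M)%N -> x i = y i].
Proof.
have nx (s : seq (cell m)) :
    nbhs x [set y : config A m | forall i, i \in s -> x i = y i].
  elim: s => [|i s IH]; first by apply: filterS filterT => y _.
  have := @proj_continuous (cell m) (fun=> discrete_topology A) i x _
    (discrete_set1 (x i : discrete_topology A)).
  move=> /(filterI IH); apply: filterS => y [/= sy iy] j.
  by rewrite inE => /orP[/eqP->|/sy].
by apply: filterS (nx (ball_cells m M)) => y /= xy i /mem_ball_cells /xy.
Qed.

Variable S : subshift A m.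
Implicit Types (u v : S) (i j d : cell m).

Definition site u i : A := set_val u i.

Lemma site_inj u v : (forall i, site u i = site v i) -> u = v.
Proof. by move=> uv; apply: val_inj; apply/funext => i; exact: uv. Qed.

Definition agree M u v := forall i, (absc i <= M)%N -> site u i = site v i.

Lemma nbhs_agree M u : nbhs u (agree M u).
Proof.
exact: (@initial_continuous _ _ (set_val : S -> config A m) u _
  (nbhs_cylinder M (set_val u))).
Qed.

Lemma agree_cvg (f : nat -> S) u :
  (forall M, exists N, forall n, (N <= n)%N -> agree M u (f n)) ->
  f n @[n --> \oo] --> u.
Proof.
move=> fu U /=; rewrite nbhsE => -[V [[W oW <-] /= Wu] VU].
have Wn : nbhs (set_val u) W by apply: open_nbhs_nbhs.
have cv : (fun n => set_val (f n)) @ \oo --> set_val u.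
  apply/cvg_sup => i B /= [C [[D oD <-] /= Du DB]].
  have [N fN] := fu (absc i); exists N => //= n /= Nn; apply: DB => /=.
  by rewrite -[set_val (f n) i](fN n Nn i (leqnn _)).
have [N _ NW] := cv _ Wn; exists N => // n Nn; apply: VU; exact: NW.
Qed.

(** A neighbourhood that contains no cylinder around [u] would be avoided by a
    sequence that agrees with [u] on larger and larger balls. *)
Lemma agree_nbhs u (U : set S) : nbhs u U -> exists M, agree M u `<=` U.
Proof.
move=> nU; apply: contrapT => /forallNP h.
have /choice[f fP] M : exists v, agree M u v /\ ~ U v.
  have /existsNP[v /not_implyP[]] := h M.
  by exists v.
have : f n @[n --> \oo] --> u.
  apply: agree_cvg => M; exists M => n Mn i iM; apply: (fP n).1.
  exact: leq_trans Mn.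
move=> /(_ U nU) [N _ /(_ N (leqnn N))]; exact: (fP N).2.
Qed.

Lemma config_compact : compact [set: config A m].
Proof.
have cA : compact [set: discrete_topology A].
  by apply: finite_compact; exact: (@finite_finset A).
have := @tychonoff (cell m) (fun=> discrete_topology A) (fun=> setT) (fun=> cA).
by rewrite (_ : [set _ | _] = setT) //; apply/seteqP; split.
Qed.

Lemma seq_compact (f : nat -> S) : exists (phi : nat -> nat) u,
  {homo phi : s t / (s < t)%N} /\
  forall M, exists N, forall n, (N <= n)%N -> agree M u (f (phi n)).
Proof.
have Sc : compact (S : set (config A m)).
  apply: subclosed_compact config_compact _ => //.
  by have [] := subshiftP S.
have [x [Sx cx]] := Sc ((fun n => set_val (f n)) @ \oo) _
  (ex_intro2 _ _ 0%N I (fun n _ => set_valP (f n))).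
pose u : S := SigSub (mem_set Sx).
have /choice[g gP] (MN : nat * nat) :
    exists n, (MN.2 <= n)%N /\ agree MN.1 u (f n).
  have /cx /(_ (nbhs_cylinder MN.1 x)) :
      ((fun n => set_val (f n)) @ \oo)
        [set y | exists2 n, (MN.2 <= n)%N & y = set_val (f n)].
    by exists MN.2 => // n /= ?; exists n.
  by move=> [_ [[n Mn ->] xf]]; exists n.
pose phi := fix phi n := if n is k.+1 then g (n, (phi k).+1) else g (0, 0)%N.
exists phi, u; split.
  apply: homo_ltn; first by move=> ? ? ?; exact: ltn_trans.
  by move=> n /=; exact: (gP (n.+1, (phi n).+1)).1.
move=> M; exists M => -[|n] Mn i iM; apply: (gP (_, _)).2 => /=;
  exact: leq_trans Mn.
Qed.

(** A form of the Baire category theorem, relative to a set [P] of points that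
    need not be closed: the sets [D n] are open, and dense from the viewpoint
    of the points of [P].  Nested cylinders centred at points of [P] shrink
    into the [D n]; their common point may lie outside [P]. *)
Lemma baire (P : set S) (D : nat -> set S) u0 : P u0 ->
  (forall n u, D n u -> exists M, agree M u `<=` D n) ->
  (forall n u M, P u -> exists v, [/\ P v, D n v & agree M u v]) ->
  exists u, forall n, D n u.
Proof.
move=> Pu0 Dop Dden.
(* One step: refine a cylinder into [D n], and enlarge its radius strictly. *)
have /choice[g gP] (a : nat * (S * nat)) : exists vM, P a.2.1 ->
    [/\ P vM.1, agree vM.2 vM.1 `<=` D a.1, agree a.2.2 a.2.1 vM.1 &
        (a.2.2 < vM.2)%N].
  case: a => n [u M] /=; have [Pu|] := pselect (P u); last by exists (u, M).
  have [v [Pv Dv uv]] := Dden n u M Pu.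
  have [M' vM'] := Dop _ _ Dv.
  exists (v, maxn M.+1 M') => _; split=> //=; last by rewrite leq_max leqnn.
  move=> w vw; apply: vM' => i iM; apply: vw.
  by rewrite leq_max iM orbT.
pose s := fix s n := if n is k.+1 then g (k, s k) else (u0, 0%N).
have sP n : P (s n).1.
  elim: n => //= n IH; by have [] := gP (n, s n) IH.
have sM n : (n <= (s n).2)%N.
  elim: n => //= n IH; have [_ _ _] := gP (n, s n) (sP n).
  exact: leq_trans.
have sS n k : (n <= k)%N ->
    ((s n).2 <= (s k).2)%N /\ agree (s n).2 (s n).1 (s k).1.
  elim: k => [|k IH]; first by rewrite leqn0 => /eqP ->.
  rewrite leq_eqVlt => /orP[/eqP -> //|/IH [le ag]].
  have [_ _ ag' lt] := gP (k, s k) (sP k).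
  split; first exact: leq_trans le (ltnW lt).
  move=> i iM; rewrite ag //; apply: ag' => /=; exact: leq_trans le.
have [phi [u [phom phu]]] := seq_compact (fun n => (s n).1).
exists u => n.
have [_ sub _ _] := gP (n, s n) (sP n); apply: sub; rewrite -/(s n.+1).
move=> i iM; have [N uN] := phu (absc i).
pose k := maxn N n.+1.
rewrite (uN k) ?leq_max ?leqnn //.
apply: (sS n.+1 (phi k) _).2 => //.
by apply: leq_trans (homo_ltn_geq k phom); rewrite leq_max leqnn orbT.
Qed.

End subshift_topology.

(** * Translations and the local rule *)

Section subshift_dynamics.
Context (A : finType) (m : sidedness) (S : subshift A m).
Implicit Types (u v : S) (i j d : cell m).

Lemma site_iter_sigma k u i : site (iter k (@sigma A m S) u) i = site u (k%:R + i).
Proof.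
elim: k i => [|k IH] i; first by rewrite add0r.
by rewrite iterS -addn1 natrD -addrA [1 + i]addrC -IH.
Qed.

Lemma iter_sigma_surj k v : m = twosided -> exists u, iter k (@sigma A m S) u = v.
Proof.
move=> mE; elim: k v => [|k IH] v; first by exists v.
have [w wv] : exists w, sigma w = v.
  have [_ _] := subshiftP S; rewrite {1}mE => Sm.
  have : subshift_set S (set_val v) by exact: set_valP.
  rewrite -[X in X _]Sm => -[x Sx xv]; exists (SigSub (mem_set Sx)).
  exact: val_inj.
have [u uw] := IH w.
by exists u; rewrite iterS uw.
Qed.

Lemma cell_cases i : (exists k : nat, i = k%:R) \/
  (m = twosided /\ exists k : nat, k%:R + i = 0).
Proof.
case: m i => i; first by left; exists i; rewrite natn.
case: i => n; first by left; exists n; rewrite natz.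
by right; split=> //; exists n.+1; rewrite natz NegzE addrN.
Qed.

(** Every cell can be moved to the origin inside the subshift: to the left by
    iterating the shift, and to the right, in the twosided case, by its
    surjectivity. *)
Lemma translate_ex i u : exists v, forall j, site v j = site u (i + j).
Proof.
have [[k ->]|[mE [k ki]]] := cell_cases i.
  by exists (iter k (@sigma A m S) u) => j; rewrite site_iter_sigma.
have [v vu] := iter_sigma_surj k u mE.
by exists v => j; rewrite -vu site_iter_sigma addrA ki add0r.
Qed.

Section pca.
Variable F : S -> S.
Hypothesis F_pca : partial_cellular_automaton F.

Lemma F_iter_sigma k u : F (iter k (@sigma A m S) u) = iter k (@sigma A m S) (F u).
Proof.
elim: k => // k IH; rewrite !iterS -IH.
exact: (congr1 (fun f => f _) F_pca.2).
Qed.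

Lemma F_translate i u v : (forall j, site v j = site u (i + j)) ->
  forall j, site (F v) j = site (F u) (i + j).
Proof.
move=> vu j; have [[k iE]|[_ [k ki]]] := cell_cases i.
  have -> : v = iter k (@sigma A m S) u.
    by apply: site_inj => j'; rewrite site_iter_sigma vu iE.
  by rewrite F_iter_sigma site_iter_sigma iE.
have -> : u = iter k (@sigma A m S) v.
  by apply: site_inj => j'; rewrite site_iter_sigma vu addrA [i + _]addrC ki add0r.
by rewrite F_iter_sigma site_iter_sigma addrA ki add0r.
Qed.

Lemma iterF_translate t i u v : (forall j, site v j = site u (i + j)) ->
  forall j, site (iter t F v) j = site (iter t F u) (i + j).
Proof. by move=> vu; elim: t => // t IH j; exact: F_translate. Qed.

(** Curtis-Hedlund-Lyndon: if no radius worked for cell 0, pairs of points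
    agreeing on larger and larger balls but with distinct images at 0 would
    accumulate at a point where [F] is discontinuous. *)
Lemma local_rule : exists r, forall u v i,
  (forall d, (absc d <= r)%N -> site u (i + d) = site v (i + d)) ->
  site (F u) i = site (F v) i.
Proof.
have [r rP] : exists r, forall u v, agree r u v -> site (F u) 0 = site (F v) 0.
  apply: contrapT => /forallNP h.
  have /choice[f fP] n : exists uv : S * S,
      agree n uv.1 uv.2 /\ site (F uv.1) 0 <> site (F uv.2) 0.
    have /existsNP[u /existsNP[v /not_implyP[]]] := h n.
    by exists (u, v).
  have [phi [u [phom phu]]] := seq_compact (fun n => (f n).1).
  have [M uM] := agree_nbhs (F_pca.1 u _ (nbhs_agree 0 (F u))).
  have [N uN] := phu M.
  pose n := maxn N M.
  have ag1 : agree M u (f (phi n)).1 by apply: uN; rewrite leq_maxl.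
  have ag2 : agree M u (f (phi n)).2.
    move=> i iM; rewrite ag1 //; apply: (fP _).1.
    by rewrite (leq_trans iM) // (leq_trans _ (homo_ltn_geq n phom)) // leq_maxr.
  apply: (fP (phi n)).2.
  by rewrite -[LHS](uM _ ag1 0) -?[RHS](uM _ ag2 0) ?absc0.
exists r => u v i uv.
have [u' u'P] := translate_ex i u.
have [v' v'P] := translate_ex i v.
rewrite -[i]addr0 -(F_translate u'P) -(F_translate v'P); apply: rP.
by move=> d dr; rewrite u'P uv // -v'P.
Qed.

End pca.

(** A subshift of finite type is defined by its local patterns, so
    configurations that locally look like points of it can be glued. *)
Lemma finite_type_local : finite_type S -> exists r, forall x : config A m,
  (forall i, exists u, forall d, (absc d <= r)%N -> x (i + d) = site u (i + d)) ->
  subshift_set S x.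
Proof.
move=> [L finL SE].
have [l lP] : exists l, forall w, L w -> (size w <= l)%N.
  have /finite_seqP[s ->] := finL.
  exists (\max_(w <- s) size w) => w /= ws.
  by rewrite (big_rem w ws) /= leq_max leqnn.
exists l => x xP; rewrite SE => w Lw [i iw].
have [u uP] := xP i.
have := set_valP u; rewrite /= {1}SE => /(_ w Lw); apply; exists i.
rewrite -[RHS]iw; apply/eq_in_map => k; rewrite mem_iota => /= kw.
rewrite -[LHS]/(site u _) -uP // absc_natr ltnW // (leq_trans kw) //; exact: lP.
Qed.

(** A point with a dense positive orbit visits every cylinder; as it also
    returns to its own cylinders, each visit is followed by a later one. *)
Lemma universal_point : transitive_subshift S -> exists z : S, forall u M K,
  exists2 k : nat, (K <= k)%N &
    forall d, (absc d <= M)%N -> site z (k%:R + d) = site u d.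
Proof.
move=> [G [D Dod GE] Gsub].
have [[x Sx] _ _] := subshiftP S.
have [z zD] : exists z, forall n, D n z.
  apply: (@baire _ _ S setT D (SigSub (mem_set Sx))) => //.
    move=> n u Du; apply: agree_nbhs; apply: open_nbhs_nbhs.
    by split; first exact: (Dod n).1.
  move=> n u M _; have [v [uv Dv]] : (agree M u)° `&` D n !=set0.
    apply: (Dod n).2; last exact: open_interior.
    by exists u; exact: nbhs_agree.
  by exists v; split => //; exact: interior_subset uv.
have zdense : dense (positive_orbit z).
  by apply: Gsub; rewrite GE => n _; exact: zD.
have visit u M : exists2 t, (1 <= t)%N &
    forall d, (absc d <= M)%N -> site z (t%:R + d) = site u d.
  have [v [uv [t t1 tv]]] : (agree M u)° `&` positive_orbit z !=set0.
    apply: zdense; last exact: open_interior.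
    by exists u; exact: nbhs_agree.
  exists t => // d dM; rewrite -site_iter_sigma tv.
  by rewrite (interior_subset uv d dM).
exists z => u M; elim=> [|K [k Kk kP]].
  by have [t _ tP] := visit u M; exists t.
have [t t1 tP] := visit z (k + M)%N.
exists (t + k)%N; first by rewrite -addn1 addnC leq_add.
move=> d dM; rewrite natrD -addrA tP ?kP //.
by rewrite (leq_trans (absc_addl _ _)) // absc_natr leq_add2l.
Qed.

(** * Pointwise decay *)

Section pointwise_decay.
Variables (zero : A) (F : S -> S).
Hypothesis F_asym : asymptotically_nilpotent_to zero F.

Lemma zero_point : exists o : S, forall i, site o i = zero.
Proof.
have : (set_val @` asymptotic_set F) (const_config zero) by rewrite F_asym.
by move=> [o _ oE]; exists o => i; rewrite /site oE.
Qed.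

(** Otherwise the times at which the orbit is non-zero on the ball have, by
    compactness, a subsequence along which it converges to a non-zero point of
    the asymptotic set. *)
Lemma orbit_vanishes u M : exists T, forall t, (T <= t)%N ->
  forall i, (absc i <= M)%N -> site (iter t F u) i = zero.
Proof.
apply: contrapT => /forallNP h.
have /choice[f fP] T : exists t, (T <= t)%N /\
    exists2 i, (absc i <= M)%N & site (iter t F u) i <> zero.
  have /existsNP[t /not_implyP[Tt /existsNP[i /not_implyP[iM ui]]]] := h T.
  by exists t; split=> //; exists i.
pose s := fix s n := if n is k.+1 then f (s k).+1 else f 0%N.
have s_hom : {homo s : a b / (a < b)%N}.
  apply: homo_ltn; first by move=> ? ? ?; exact: ltn_trans.
  by move=> n /=; exact: (fP _).1.
have sP n : exists2 i, (absc i <= M)%N & site (iter (s n) F u) i <> zero.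
  by case: n => [|n]; exact: (fP _).2.
have [phi [v [phom phv]]] := seq_compact (fun n => iter (s n) F u).
have : (set_val @` asymptotic_set F) (set_val v).
  exists v => //; exists u, (s \o phi).
    by move=> a b /phom /s_hom.
  exact: agree_cvg.
rewrite F_asym => vE.
have [N vN] := phv M.
have [i iM] := sP (phi N); apply.
by rewrite -(vN N (leqnn N) i iM) /site vE.
Qed.

End pointwise_decay.
End subshift_dynamics.

(** * Collars of zeros *)

Section collars.
Context (m : sidedness).
Implicit Types (i j c d : cell m).

(** [V] is wide enough to separate the region [I] from its complement: the
    ball of radius [r] around a cell does not meet both sides outside [V]. *)
Definition collar (r : nat) (I : pred (cell m)) (V : set (cell m)) := forall i,
  (forall d, (absc d <= r)%N -> I (i + d) \/ V (i + d)) \/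
  (forall d, (absc d <= r)%N -> ~~ I (i + d) \/ V (i + d)).

Definition thickening (r : nat) (C : set (cell m)) : set (cell m) :=
  [set j | exists c d, [/\ C c, (absc d <= r)%N & j = c + d]].

Lemma ball_collar r K :
  collar r (fun i => (absc i <= K)%N)
    [set i | (K < absc i + r)%N /\ (absc i <= K + r)%N].
Proof.
move=> i; have [iK|iK] := leqP (absc i) K; [left|right] => d dr /=.
  have := absc_addl i d; have [le|lt] := leqP (absc (i + d)) K => le'; first by left.
  by right; split; lia.
have := absc_subl i d; have [le|lt] := leqP (absc (i + d)) K => le'; last by left.
by right; split; lia.
Qed.

End collars.

(** The collar consists of the walls centred at [k1] and [k2], in coordinates
    relative to the cell [p] between them.  Onesided configurations are closed
    off by the right wall alone, because a cell depends on nothing to its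
    left. *)
Lemma interval_collar m r M (k1 p k2 : nat) :
  (k1 + M <= p)%N -> (p + M <= k2)%N ->
  exists (I : pred (cell m)) M',
  [/\ collar r I (thickening r [set c | p%:R + c = k1%:R \/ p%:R + c = k2%:R]),
      forall i, (absc i <= M)%N -> I i & forall i, I i -> (absc i <= M')%N].
Proof.
move=> k1p pk2; case: m.
  exists (fun i : nat => (i <= k2 - p)%N), (k2 - p)%N; split.
  - move=> i; have [ik|ik] := leqP (i : nat) (k2 - p)%N; [left|right] => d dr.
      have [le|lt] := leqP ((i + d) : nat)%R (k2 - p)%N; [by left|right].
      exists (k2 - p)%N, (i + d - (k2 - p))%N; split.
      + by right; rewrite !natn; exact: (subnKC (leq_trans (leq_addr M p) pk2)).
      + move: dr lt => /=; lia.
      + by rewrite /=; exact/esym/subnKC/ltnW.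
    by left; rewrite -ltnNge; exact: leq_trans ik (leq_addr _ _).
  - move=> i /= ; lia.
  - by [].
pose a : int := k1%:Z - p%:Z; pose b : int := k2%:Z - p%:Z.
exists (fun i : int => (a <= i <= b)%R), (maxn `|a| `|b|); split.
- have near (c i : int) : (p%:Z + c = k1%:Z \/ p%:Z + c = k2%:Z) ->
    (`|i - c| <= r)%N -> thickening r
      [set c : cell twosided | p%:R + c = k1%:R \/ p%:R + c = k2%:R] i.
    move=> cP ic; exists c, (i - c); split=> //; first by rewrite /= !natz.
    by rewrite addrC subrK.
  move=> i; have [ik|ik] := boolP ((a <= i :> int) && (i <= b :> int))%R;
    [left|right] => d dr;
    have [ik'|ik'] := boolP ((a <= i + d :> int) && (i + d <= b :> int))%R.
  + by left.
  + right; have [ai|ai] := boolP (a <= i + d :> int)%R.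
      by apply: (near b); [right|]; move: dr ik ik' ai; rewrite /a /b /=; lia.
    by apply: (near a); [left|]; move: dr ik ik' ai; rewrite /a /b /=; lia.
  + right; have [ai|ai] := boolP (a <= i :> int)%R.
      by apply: (near b); [right|]; move: dr ik ik' ai; rewrite /a /b /=; lia.
    by apply: (near a); [left|]; move: dr ik ik' ai; rewrite /a /b /=; lia.
  + by left.
- move=> i; rewrite /a /b /=; lia.
- move=> i; rewrite /a /b /=; lia.
Qed.

(** * From pointwise to uniform decay *)

Section asymptotic_to_uniform.
Context (A : finType) (m : sidedness) (S : subshift A m).
Variables (zero : A) (F : S -> S) (o : S) (r : nat).
Implicit Types (u v w : S) (i j d : cell m) (M N n t : nat).

Hypothesis site_o : forall i, site o i = zero.
Hypothesis F_local : forall u v i,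
  (forall d, (absc d <= r)%N -> site u (i + d) = site v (i + d)) ->
  site (F u) i = site (F v) i.
Hypothesis S_local : forall x : config A m,
  (forall i, exists u, forall d, (absc d <= r)%N -> x (i + d) = site u (i + d)) ->
  subshift_set S x.
Hypothesis F_pca : partial_cellular_automaton F.
Hypothesis F_asym : asymptotically_nilpotent_to zero F.

(** A late point of the orbit of [o] is zero around [i], and its image is zero
    at [i]; by locality, so is the image of [o] itself. *)
Lemma iterF_zero t : iter t F o = o.
Proof.
suff Fo : F o = o by elim: t => // t /= ->.
apply: site_inj => i.
have [T TP] := orbit_vanishes F_asym o (absc i + r).
rewrite (@F_local o (iter T F o) i).
  by rewrite -iterS TP ?site_o ?leq_addr ?leqW.
move=> d dr; rewrite TP ?site_o //.
by rewrite (leq_trans (absc_addl _ _)) // leq_add2l.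
Qed.

Lemma agree_iter t M u v : agree (M + t * r) u v ->
  agree M (iter t F u) (iter t F v).
Proof.
elim: t M => [|t IH] M; first by rewrite addn0.
rewrite mulSn addnA => /IH uv i iM; apply: F_local => d dr; apply: uv.
by rewrite (leq_trans (absc_addl _ _)) // leq_add.
Qed.

(** If late non-zero states were dense from the viewpoint of [P], [baire] would
    give a point whose orbit does not vanish on the ball. *)
Lemma uniform_vanishing (P : set S) M u0 : P u0 -> exists u K J,
  P u /\ forall v, P v -> agree K u v -> forall t, (J <= t)%N ->
    forall i, (absc i <= M)%N -> site (iter t F v) i = zero.
Proof.
move=> Pu0; apply: contrapT => h.
pose D n u := exists2 t, (n <= t)%N &
  exists2 i, (absc i <= M)%N & site (iter t F u) i <> zero.
have [u uD] : exists u, forall n, D n u.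
  apply: (baire Pu0) => [n u [t nt [i iM ui]]|n u K Pu].
    exists (M + t * r)%N => v /agree_iter uv; exists t => //; exists i => //.
    by rewrite -(uv i iM).
  apply: contrapT => nv; apply: h; exists u, K, n; split=> // v Pv uv t nt i iM.
  apply: contrapT => vi; apply: nv; exists v; split=> //.
  by exists t => //; exists i.
have [T TP] := orbit_vanishes F_asym u M.
by have [t Tt [i iM]] := uD T; apply; exact: TP.
Qed.

Definition patch (I : pred (cell m)) u v : config A m :=
  fun i => if I i then site u i else site v i.

Section patching.
Variables (I : pred (cell m)) (V : set (cell m)) (u v : S).
Hypothesis uv : forall j, V j -> site u j = site v j.

Lemma patch_inside i : I i \/ V i -> patch I u v i = site u i.
Proof. by rewrite /patch; case: ifP => // _ [//|/uv]. Qed.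

Lemma patch_outside i : ~~ I i \/ V i -> patch I u v i = site v i.
Proof. by rewrite /patch; case: ifP => // _ [//|/uv]. Qed.

End patching.

(** Two points that share the same evolution on a collar evolve independently
    on its two sides.  The spliced point depends only on the initial states, so
    it serves for every duration [n] during which the collar is shared. *)
Lemma splice I V u v : collar r I V -> (forall j, V j -> site u j = site v j) ->
  exists w, forall n,
    (forall t j, (t <= n)%N -> V j -> site (iter t F u) j = site (iter t F v) j) ->
    forall i, site (iter n F w) i = patch I (iter n F u) (iter n F v) i.
Proof.
move=> IV uv.
have Sp : subshift_set S (patch I u v).
  apply: S_local => i; have [h|h] := IV i; [exists u|exists v] => d /h.
    exact: patch_inside.
  exact: patch_outside.
exists (SigSub (mem_set Sp)); elim=> [|n IH] // uvn i.
have {}IH := IH (fun t j tn => uvn t j (leqW tn)).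
have uvn0 j : V j -> site (iter n F u) j = site (iter n F v) j by exact: uvn.
have uvn1 j : V j -> site (iter n.+1 F u) j = site (iter n.+1 F v) j by exact: uvn.
have [h|h] := IV i.
  rewrite (@patch_inside I V) //; last by rewrite -[i]addr0; apply: h; rewrite absc0.
  by apply: F_local => d dr; rewrite IH (patch_inside uvn0 (h d dr)).
rewrite (@patch_outside I V) //; last by rewrite -[i]addr0; apply: h; rewrite absc0.
by apply: F_local => d dr; rewrite IH (patch_outside uvn0 (h d dr)).
Qed.

Definition late_nonzero := forall q, exists t u,
  (q <= t)%N /\ site (iter t F u) 0 <> zero.

(** Points that are non-zero in cell 0 at late times follow, for as long as one
    wishes, the orbit of one of their limits, and that orbit dies out on the
    ball. *)
Lemma late_revival M L s0 : late_nonzero -> exists u s t, [/\ (s0 <= s)%N,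
  forall k i, (k <= L)%N -> (absc i <= M)%N -> site (iter (s + k) F u) i = zero &
  site (iter (s + t) F u) 0 <> zero].
Proof.
move=> nu.
have /choice[f fP] q : exists tu : nat * S,
    (q <= tu.1)%N /\ site (iter tu.1 F tu.2) 0 <> zero.
  by have [t [u]] := nu q; exists (t, u).
have [phi [x [phom phx]]] := seq_compact (fun n => (f n).2).
have [T TP] := orbit_vanishes F_asym x M.
pose s := maxn T s0.
have [N xN] := phx (M + (s + L) * r)%N.
pose n := maxn N s.
have [tn un] := fP (phi n).
exists (f (phi n)).2, s, ((f (phi n)).1 - s)%N; split.
- exact: leq_maxr.
- move=> k i kL iM.
  have xu : agree (M + (s + k) * r) x (f (phi n)).2.
    move=> j jM; apply: (xN n); first exact: leq_maxl.
    by rewrite (leq_trans jM) // leq_add2l leq_mul2r leq_add2l kL orbT.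
  rewrite -(agree_iter xu) //; apply: TP => //.
  by rewrite (leq_trans (leq_maxl T s0)) // leq_addr.
- rewrite subnKC //; apply: leq_trans tn.
  by apply: leq_trans (homo_ltn_geq n phom); exact: leq_maxr.
Qed.

(** The case of all points and of the ball of radius [r] in
    [uniform_vanishing], translated to an arbitrary cell [i]: the zeros last
    whatever surrounds the occurrence of [x], and their block is as wide as a
    collar requires. *)
Lemma wall_word : exists (x : S) K J, forall u i,
  (forall d, (absc d <= K)%N -> site u (i + d) = site x d) ->
  forall t d, (J <= t)%N -> (absc d <= r)%N -> site (iter t F u) (i + d) = zero.
Proof.
have [x [K [J [_ xP]]]] := @uniform_vanishing setT r o I.
exists x, K, J => u i ux t d Jt dr.
have [v vu] := translate_ex i u.
rewrite -(iterF_translate F_pca _ vu); apply: xP => // j jK.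
by rewrite -[LHS]ux // -vu.
Qed.

(** * Confined points *)

Variable z : S.
Hypothesis z_universal : forall u M K, exists2 k : nat, (K <= k)%N &
  forall d, (absc d <= M)%N -> site z (k%:R + d) = site u d.

Definition confined N u := forall t i, (N < absc i)%N -> site (iter t F u) i = zero.

Lemma confined_mortal N u : confined N u ->
  exists T, forall t, (T <= t)%N -> forall i, site (iter t F u) i = zero.
Proof.
move=> uN; have [T TP] := orbit_vanishes F_asym u N; exists T => t Tt i.
by case: (leqP (absc i) N) => [/TP->|/uN].
Qed.

(** The word responsible for a late revival is found between two walls in the
    universal point [z]; from the revival's starting time [s] on the walls are
    zero, so everything beyond them can be replaced by zeros. *)
Lemma confined_late_revival M L : late_nonzero -> exists u N t, [/\ confined N u,
  forall k i, (k <= L)%N -> (absc i <= M)%N -> site (iter k F u) i = zero &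
  site (iter t F u) 0 <> zero].
Proof.
move=> nu; have [x [K [J xP]]] := wall_word.
have [u [s [t [Js sL st]]]] := late_revival M L J nu.
(* Agreement on this ball is inherited on the ball [M] up to time s + L + t. *)
pose N := (M + (s + (L + t)) * r)%N.
have [k1 _ k1P] := z_universal x K 0.
have [p pP upP] := z_universal u N (k1 + M).
have [k2 k2P xk2P] := z_universal x K (p + M).
have [v vz] := translate_ex p%:R z.
have uv : agree N u v by move=> d dN; rewrite vz upP.
have uvt k : (k <= L + t)%N -> agree M (iter (s + k) F u) (iter (s + k) F v).
  move=> kL; apply: agree_iter => i iM; apply: uv.
  by rewrite (leq_trans iM) // leq_add2l leq_mul2r leq_add2l kL orbT.
have [I [M' [IV MI IM']]] := interval_collar m r pP k2P.
have zV n j : thickening r [set c | p%:R + c = k1%:R \/ p%:R + c = k2%:R] j ->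
    site (iter n F (iter s F v)) j = zero.
  move=> [c [d [cP dr ->]]]; rewrite -iterD; apply: xP => //.
    move=> e eK; rewrite vz addrA.
    by case: cP => ->; [exact: k1P | exact: xk2P].
  by rewrite (leq_trans Js) // leq_addl.
have [|w wP] := @splice I _ (iter s F v) o IV.
  by move=> j /(zV 0%N) /= ->; rewrite site_o.
have {}wP n i : site (iter n F w) i =
    if I i then site (iter (s + n) F v) i else zero.
  rewrite wP /patch.
    by rewrite -iterD addnC iterF_zero site_o.
  by move=> k j _ /zV ->; rewrite iterF_zero site_o.
have wE k i : (k <= L + t)%N -> (absc i <= M)%N ->
    site (iter k F w) i = site (iter (s + k) F u) i.
  by move=> kL iM; rewrite wP MI // [RHS](uvt k kL i iM).
exists w, M', t; split.
- by move=> n i iM'; rewrite wP; case: ifP => // /IM'; rewrite leqNgt iM'.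
- move=> k i kL iM; rewrite wE ?sL //; exact: leq_trans (leq_addr _ _).
- by rewrite wE ?absc0 // leq_addl.
Qed.

(** Around the confined point [u], put another one that stays zero near it
    until [u] is dead, and revives cell 0 later than that and than [n].  The
    cells that are zero in both in the meantime serve as collar. *)
Lemma superposition N u M n : late_nonzero -> confined N u ->
  exists v N', [/\ confined N' v, agree M u v &
    exists2 t, (n <= t)%N & site (iter t F v) 0 <> zero].
Proof.
move=> nu uN0.
(* Outside the ball [N1] the point [u] is zero; the boundary of the ball [K] is
   where the two points are spliced, with [r] zeros on each side. *)
pose N1 := maxn N M; pose K := (N1 + r)%N.
have uN t i : (N1 < absc i)%N -> site (iter t F u) i = zero.
  by move=> iN; apply: uN0; apply: leq_ltn_trans iN; exact: leq_maxl.
have [T TP] := confined_mortal uN0.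
pose L := maxn T n.
have [y [N' [t [yN' yL yt]]]] := confined_late_revival (K + r) L nu.
have yK k i : (k <= L)%N -> (absc i <= K)%N -> site (iter k F y) i = zero.
  by move=> kL iK; apply: yL => //; exact: leq_trans (leq_addr _ _).
have V0 k j : (k <= L)%N -> (K < absc j + r)%N /\ (absc j <= K + r)%N ->
    site (iter k F u) j = site (iter k F y) j.
  by move=> kL [jN jK]; rewrite yL // uN //; move: jN; rewrite /K ltn_add2r.
have [|w wP] := splice (ball_collar (m := m) r K) (u := u) (v := y).
  by move=> j; exact: (V0 0%N).
have {}wP k i : (k <= L)%N -> site (iter k F w) i =
    if (absc i <= K)%N then site (iter k F u) i else site (iter k F y) i.
  by move=> kL; rewrite wP // => k' j k'k; apply: V0; exact: leq_trans kL.
have TL : (T <= L)%N by exact: leq_maxl.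
have wT : iter T F w = iter T F y.
  apply: site_inj => i; rewrite wP //; case: ifP => // iK.
  by rewrite TP // yK.
have wy k : (T <= k)%N -> iter k F w = iter k F y.
  by move=> /subnK <-; rewrite !iterD wT.
have tL : (L < t)%N.
  by rewrite ltnNge; apply/negP => tL; apply: yt; apply: yK; rewrite ?absc0.
exists w, (maxn K N'); split.
- move=> k i; rewrite gtn_max => /andP[Ki N'i].
  have [kT|Tk] := leqP k T; last by rewrite wy ?yN' // ltnW.
  by rewrite wP ?(leq_trans kT) // leqNgt Ki yN'.
- move=> i iM; rewrite (wP 0%N) //=.
  by rewrite ifT // (leq_trans iM) // (leq_trans (leq_maxr N M)) // leq_addr.
- exists t; last by rewrite wy // ltnW // (leq_ltn_trans TL).
  by rewrite (leq_trans _ (ltnW tL)) // leq_maxr.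
Qed.

Lemma no_late_nonzero : ~ late_nonzero.
Proof.
move=> nu.
have o_conf : exists N, confined N o.
  by exists 0%N => t i _; rewrite iterF_zero site_o.
have [u [K [J [[N uN] uP]]]] :=
  @uniform_vanishing (fun u => exists N, confined N u) 0 o o_conf.
have [v [N' [vN' uv [t Jt]]]] := superposition K J nu uN.
by apply; apply: (uP v) => //; [exists N'|rewrite absc0].
Qed.

End asymptotic_to_uniform.

(** * The theorem *)

Theorem theorem4 (A : finType) (zero : A) (m : sidedness) (S : subshift A m)
    (F : S -> S) (F_pca : partial_cellular_automaton F)
    (S_sft : finite_type S) (S_trans : transitive_subshift S)
    (F_asym : asymptotically_nilpotent_to zero F) :
  nilpotent_to zero F.
Proof.
have [o oP] := zero_point F_asym.
have [r1 F_loc] := local_rule F_pca.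
have [r2 S_loc] := finite_type_local S_sft.
have [z zP] := universal_point S_trans.
pose r := maxn r1 r2.
have F_loc' : forall (u v : S) i,
    (forall d, (absc d <= r)%N -> site u (i + d) = site v (i + d)) ->
    site (F u) i = site (F v) i.
  by move=> u v i uv; apply: F_loc => d dr; apply: uv; rewrite leq_max dr.
have S_loc' : forall x : config A m,
    (forall i, exists u : S, forall d, (absc d <= r)%N ->
      x (i + d) = site u (i + d)) -> subshift_set S x.
  move=> x xP; apply: S_loc => i; have [u uP] := xP i.
  by exists u => d dr; apply: uP; rewrite leq_max dr orbT.
have nnu := no_late_nonzero oP F_loc' S_loc' F_pca F_asym zP.
have [q qP] : exists q, forall t u, (q <= t)%N -> site (iter t F u) 0 = zero.
  apply: contrapT => nq; apply: nnu => q; apply: contrapT => nt; apply: nq.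
  by exists q => t u qt; apply: contrapT => tu; apply: nt; exists t, u.
have Ft t u : (q <= t)%N ->
    set_val (iter t F u) = const_config zero :> config A m.
  move=> qt; apply/funext => i.
  have [v vu] := translate_ex i u.
  rewrite -[LHS]/(site _ i) -[i]addr0 -(iterF_translate F_pca _ vu); exact: qP.
exists q => t qt; apply/seteqP; split => [x [_ [u _ <-] <-]|_ ->].
  exact: Ft.
exists (iter t F o); last exact: Ft.
by exists o.
Qed.
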